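(* Let $f:\mathbb{R}^m\to\mathbb{R}$ be convex and $(M,\nu)$-Hölder smooth on $\mathbb{R}^m$ with $M>0$ and $\nu\in[0,1]$, consider $p^*=\min_{y\in\mathbb{R}^n}\{p(y)=f(Ay)+g(y)\}$ in the setting of the context with $D>0$, and let $r:=MD^{\nu-1}$. Let $b\ge2$ be a constant and $$N^*:=\max\left\{4b\log_2(4b),\ (8r^2)^{\frac{1}{b-1+\nu}},\ (8/r^2)^{\frac1b}\right\}.$$ If the integer $N$ satisfies $N\ge4N^*$, then the point $y_N^{\rm best}$ output by the Unbounded-Budget Parameter Search algorithm of the context satisfies $$p(y_N^{\rm best})-p^*\le262\,MD^{\nu+1}\left(\frac{8b\log_2N}{N}\right)^{\frac{1+\nu}{2}}.$$
   Context: $\|\cdot\|$ is the Euclidean norm. Setting: $A:\mathbb{R}^n\to\mathbb{R}^m$ is linear; $g:\mathbb{R}^n\to\mathbb{R}\cup\{+\infty\}$ is proper, closed and convex; for every $\lambda\in\mathbb{R}^n$ the problem $\min_{y\in\mathbb{R}^n}\{\langle\lambda,y\rangle+g(y)\}$ has an optimal solution; the set $A(\mathrm{dom}\,g)$ is bounded, and $D:=\sup_{x,z\in A(\mathrm{dom}\,g)}\|x-z\|<+\infty$. A convex $f:\mathbb{R}^m\to\mathbb{R}$ is $(M,\nu)$-Hölder smooth on $\mathbb{R}^m$ if $0\le f(x)-f(z)-\langle s_z,x-z\rangle\le\frac{M}{1+\nu}\|x-z\|^{1+\nu}$ for all $x,z\in\mathbb{R}^m$ and all $s_z\in\partial f(z)$.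 First-order primal-dual splitting method with positive parameters $\{\eta_k\}_{k\ge0},\{\rho_k\}_{k\ge0}$: given $y_0\in\mathrm{dom}\,g$, set $x_0=Ay_0$ and $\lambda_0\in\partial f(x_0)$; for $k=0,1,2,\dots,K-1$: (i) $y_{k+1}\in\arg\min_{y\in\mathbb{R}^n}\,g(y)+\langle\lambda_k,Ay\rangle$ (one linear-minimization-oracle, LMO, call); (ii) choose $s_k\in\partial f(x_k)$; (iii) $x_{k+1}=\arg\min_{x\in\mathbb{R}^m}\langle s_k-\lambda_k,x\rangle+\frac{\eta_k}{2}\|x-x_k\|^2+\frac{\rho_k}{2}\|Ay_{k+1}-x\|^2$; (iv) $\lambda_{k+1}=\lambda_k+\rho_k(Ay_{k+1}-x_{k+1})$. All choices among minimizers and subgradients are arbitrary. The output after $K$ iterations is $\bar y_K:=\frac{\sum_{i=0}^{K-1}\alpha_iy_{i+1}}{\sum_{i=0}^{K-1}\alpha_i}$ with $\alpha_i=i+2$. Fixed-Budget Parameter Search with input $y_0\in\mathrm{dom}\,g$, budget $N$ and constant $b\ge2$: set $K:=\lfloor N/(b\log_2N)\rfloor$ and $s:=\lfloor(N/K-1)/2\rfloor$. For each integer $j=-s,\dots,s$, run the first-order primal-dual splitting method for $K$ iterations from $y_0$ with $\eta_k\equiv\eta^j:=2^j$ and $\rho_k=\frac{4\eta^j}{k+1}$ for all $k\ge 0$, and denote its output by $\bar y_K^j$. Output $\bar y_K^{j^*}$ where $j^*\in\arg\min_{-s\le j\le s}p(\bar y_K^j)$. This uses $(2s+1)K$ LMO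 calls. Unbounded-Budget Parameter Search with input $y_0\in\mathrm{dom}\,g$ and constant $b\ge2$: set $N_0:=\lceil4b\log_2(4b)\rceil$. For stages $t=0,1,2,\dots$, run Fixed-Budget Parameter Search from $y_0$ with budget $N_t:=2^tN_0$ and constant $b$; denote its output by $\hat y_t$, and let $C_t$ be the accumulated number of LMO calls over stages $0,\dots,t$. For a given $N$, let $\bar t_N:=\max\{t\ge0:C_t\le N\}$ and output $y_N^{\rm best}:=\hat y_{t_N^*}$, where $t_N^*\in\arg\min_{0\le t\le\bar t_N}p(\hat y_t)$. *)

(* Defs.v *)
From mathcomp Require Import all_boot all_order all_algebra.
From mathcomp Require Import all_classical all_reals all_analysis.
Import Order.TTheory GRing.Theory Num.Theory.
Import numFieldNormedType.Exports.

Set Implicit Arguments.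
Unset Strict Implicit.
Unset Printing Implicit Defensive.

Local Open Scope classical_set_scope.
Local Open Scope ring_scope.

Section Euclidean.
Context {R : realType}.

Definition inner d (u v : 'cV[R]_d) : R := \sum_(i < d) u i 0 * v i 0.

(* The library norm `|u| on 'cV[R]_d is the sup norm; it only serves here to
   provide the topology. *)
Definition enorm d (u : 'cV[R]_d) : R := Num.sqrt (inner u u).

Definition log2 (x : R) : R := ln x / ln 2.

Definition argmin (T : Type) (F : T -> \bar R) : set T :=
  [set y | forall z, (F y <= F z)%E].

End Euclidean.

Section ConvexAnalysis.
Context {R : realType}.

Definition edom d (g : 'cV[R]_d -> \bar R) : set 'cV[R]_d :=
  [set y | (g y < +oo)%E].

Definition eproper d (g : 'cV[R]_d -> \bar R) : Prop :=
  (forall y, (-oo < g y)%E) /\ edom g !=set0.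

Definition epigraph d (g : 'cV[R]_d -> \bar R) : set ('cV[R]_d * R) :=
  [set z | (g z.1 <= (z.2)%:E)%E].

Definition eclosed d (g : 'cV[R]_d -> \bar R) : Prop := closed (epigraph g).

(* Convexity of a function with values in R with +oo adjoined; at t = 0 and t = 1 the
   library convention 0 * +oo = 0 makes the inequality trivial. *)
Definition econvex d (g : 'cV[R]_d -> \bar R) : Prop :=
  forall (x y : 'cV[R]_d) (t : R), 0 <= t <= 1 ->
    (g (t *: x + (1 - t) *: y)%R <= t%:E * g x + (1 - t)%:E * g y)%E.

Definition subdifferential d (f : 'cV[R]_d -> R) (z : 'cV[R]_d) :
    set 'cV[R]_d :=
  [set s | forall x, f z + inner s (x - z) <= f x].

Definition holder_smooth d (M nu : R) (f : 'cV[R]_d -> R) : Prop :=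
  forall x z s : 'cV[R]_d, subdifferential f z s ->
    0 <= f x - f z - inner s (x - z)
      <= M / (1 + nu) * enorm (x - z) `^ (1 + nu).

End ConvexAnalysis.

Section Algorithms.
Context {R : realType} {m n : nat}.
Variable A : {linear 'cV[R]_n -> 'cV[R]_m}.
Variable f : 'cV[R]_m -> R.
Variable g : 'cV[R]_n -> \bar R.

Definition objective (y : 'cV[R]_n) : \bar R := ((f (A y))%:E + g y)%E.

Definition image_dom : set 'cV[R]_m := [set A y | y in edom g].

Definition image_diam : R :=
  sup [set enorm (x - z) | x in image_dom & z in image_dom].

(* One execution of K iterations; the fields constrain only the first K
   iterations of the four sequences. *)
Record pd_run (eta rho : nat -> R) (y0 : 'cV[R]_n) (K : nat)
    (y : nat -> 'cV[R]_n) (x lambda s : nat -> 'cV[R]_m) : Prop := {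
  pd_y0 : y 0%N = y0;
  pd_x0 : x 0%N = A y0;
  pd_lambda0 : subdifferential f (x 0%N) (lambda 0%N);
  pd_y : forall k, (k < K)%N ->
    argmin (fun v => (g v + (inner (lambda k) (A v))%:E)%E) (y k.+1);
  pd_s : forall k, (k < K)%N -> subdifferential f (x k) (s k);
  pd_x : forall k, (k < K)%N ->
    argmin (fun v => (inner (s k - lambda k) v
                      + eta k / 2 * enorm (v - x k) ^+ 2
                      + rho k / 2 * enorm (A (y k.+1) - v) ^+ 2)%:E)
           (x k.+1);
  pd_lambda : forall k, (k < K)%N ->
    lambda k.+1 = lambda k + rho k *: (A (y k.+1) - x k.+1) }.

Definition pd_average (y : nat -> 'cV[R]_n) (K : nat) : 'cV[R]_n :=
  (\sum_(i < K) (i + 2)%:R)^-1 *: \sum_(i < K) (i + 2)%:R *: y i.+1.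

Definition pd_output (eta rho : nat -> R) (y0 : 'cV[R]_n) (K : nat)
    (ybar : 'cV[R]_n) : Prop :=
  exists y x lambda s,
    pd_run eta rho y0 K y x lambda s /\ ybar = pd_average y K.

Definition fb_iters (b : R) (N : nat) : nat :=
  Num.truncn (N%:R / (b * log2 N%:R)).

Definition fb_radius (b : R) (N : nat) : int :=
  Num.floor ((N%:R / (fb_iters b N)%:R - 1) / 2 : R).

Definition fb_cost (b : R) (N : nat) : int :=
  (2 * fb_radius b N + 1) * (fb_iters b N)%:Z.

Definition fixed_budget_output (y0 : 'cV[R]_n) (b : R) (N : nat)
    (yhat : 'cV[R]_n) : Prop :=
  let s := fb_radius b N in
  let K := fb_iters b N in
  exists ybar : int -> 'cV[R]_n,
    (forall j : int, - s <= j <= s ->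
       pd_output (fun=> 2 ^ j) (fun k => 4 * 2 ^ j / k.+1%:R) y0 K (ybar j)) /\
    exists jstar : int,
      [/\ - s <= jstar <= s,
          forall j : int, - s <= j <= s ->
            (objective (ybar jstar) <= objective (ybar j))%E
        & yhat = ybar jstar].

(* The ceiling is positive as b >= 2, so that the absolute value only casts
   it to nat. *)
Definition ub_budget0 (b : R) : nat := `|Num.ceil (4 * b * log2 (4 * b))|%N.

Definition ub_budget (b : R) (t : nat) : nat := (2 ^ t * ub_budget0 b)%N.

Definition ub_calls (b : R) (t : nat) : int :=
  \sum_(i < t.+1) fb_cost b (ub_budget b i).

Definition ub_last_stage (b : R) (N t : nat) : Prop :=
  ub_calls b t <= N%:Z /\
  forall t' : nat, ub_calls b t' <= N%:Z -> (t' <= t)%N.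

Definition unbounded_budget_output (y0 : 'cV[R]_n) (b : R) (N : nat)
    (ybest : 'cV[R]_n) : Prop :=
  exists yhat : nat -> 'cV[R]_n,
    (forall t, fixed_budget_output y0 b (ub_budget b t) (yhat t)) /\
    exists tN tstar : nat,
      [/\ ub_last_stage b N tN,
          (tstar <= tN)%N,
          forall t, (t <= tN)%N ->
            (objective (yhat tstar) <= objective (yhat t))%E
        & ybest = yhat tstar].

End Algorithms.

(* Main.v *)
Require Import Defs.
From mathcomp Require Import all_boot all_order all_algebra.
From mathcomp Require Import all_classical all_reals all_analysis.
From mathcomp Require Import ring lra zify.
Import Order.TTheory GRing.Theory Num.Theory.
Import numFieldNormedType.Exports.

(* For a step size eta >= L := M D^(nu-1) K^((1-nu)/2), AM-GM turns the Hölder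
   bound into quadratic smoothness with modulus L and an additive error
   delta/2, where delta := L D^2 / K. Take l in the subdifferential of f at
   z := A ybar. Inexact cocoercivity bounds f z - f x_k by
   <l, z - x_k> - |s_k - l|^2 / (2 eta) + delta/2, and with rho_k = 4 eta / (k+1)
   the resulting gap, weighted by k+2, telescopes along
   (k+1)(k+2)/(8 eta) |lambda_k - l|^2 + (k+2) eta/2 |x_k - A y|^2 up to
   4 eta D^2 per step. Hence p(ybar) - p* <= 9 eta D^2 / K, that is
   18 M D^(1+nu) K^(-(1+nu)/2) as soon as L <= eta <= 2 L.
   The dyadic grid of a stage with budget n >= N* contains such an eta, and
   since the stages 0..t cost at most 2 N_t calls, some completed stage has
   N/4 < N_t <= N. *)

Local Open Scope classical_set_scope.
Local Open Scope ring_scope.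

(** * The Euclidean inner product *)

Section InnerProduct.
Context {R : realType} {d : nat}.
Implicit Types (u v w : 'cV[R]_d) (c : R).

Lemma innerC u v : inner u v = inner v u.
Proof. by apply: eq_bigr => i _; rewrite mulrC. Qed.

Lemma innerDr u v w : inner u (v + w) = inner u v + inner u w.
Proof. by rewrite /inner -big_split; apply: eq_bigr => i _; rewrite !mxE mulrDr. Qed.

Lemma innerZr u c v : inner u (c *: v) = c * inner u v.
Proof. by rewrite /inner mulr_sumr; apply: eq_bigr => i _; rewrite !mxE mulrCA. Qed.

Lemma innerDl u v w : inner (v + w) u = inner v u + inner w u.
Proof. by rewrite innerC innerDr !(innerC u). Qed.

Lemma innerZl u c v : inner (c *: v) u = c * inner v u.
Proof. by rewrite innerC innerZr innerC. Qed.

Lemma innerNr u v : inner u (- v) = - inner u v.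
Proof. by rewrite -scaleN1r innerZr mulN1r. Qed.

Lemma innerNl u v : inner (- v) u = - inner v u.
Proof. by rewrite innerC innerNr innerC. Qed.

Lemma inner_ge0 u : 0 <= inner u u.
Proof. by apply: sumr_ge0 => i _; rewrite -expr2 sqr_ge0. Qed.

Lemma inner_eq0 u : inner u u <= 0 -> u = 0.
Proof.
move=> u0; apply/colP => i; rewrite mxE; apply/eqP; rewrite -sqrf_eq0.
apply: contraTT u0; rewrite -ltNge => ui.
apply: lt_le_trans (_ : u i 0 ^+ 2 <= _); first by rewrite lt0r ui sqr_ge0.
rewrite /inner (bigD1 i)//= -expr2 lerDl.
by apply: sumr_ge0 => j _; rewrite -expr2 sqr_ge0.
Qed.

Lemma enorm_sqr u : enorm u ^+ 2 = inner u u.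
Proof. by rewrite sqr_sqrtr// inner_ge0. Qed.

Lemma enorm_ge0 u : 0 <= enorm u.
Proof. exact: sqrtr_ge0. Qed.

End InnerProduct.

Definition innerE := (@innerDr, @innerDl, @innerNr, @innerNl, @innerZr, @innerZl).

(** * Existence of subgradients of a finite convex function *)

Section Subgradients.
Context {R : realType} {d : nat}.
Implicit Types (f : 'cV[R]_d -> R) (u v w x z s : 'cV[R]_d).

Lemma convex_functionW f : convex_function setT f ->
  forall (t : R) x y, 0 <= t <= 1 ->
    f (t *: x + (1 - t) *: y) <= t * f x + (1 - t) * f y.
Proof.
move=> fconv t x y t01.
have := fconv (Itv01 (proj1 (andP t01)) (proj2 (andP t01))) x y.
by rewrite !inE => /(_ Logic.I Logic.I).
Qed.

Section Extension.
Variables (f : 'cV[R]_d -> R) (z : 'cV[R]_d).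
Hypothesis fconv : forall (t : R) x y, 0 <= t <= 1 ->
  f (t *: x + (1 - t) *: y) <= t * f x + (1 - t) * f y.

(** A partial subgradient at [z], tested only on directions in the span of the first [k]
    coordinates: trivial for k = 0, a full subgradient for k = d. *)
Definition supports (k : nat) s := forall v,
  (forall i : 'I_d, (k <= i)%N -> v i 0 = 0) -> f z + inner s v <= f (z + v).

(* One-dimensional Hahn-Banach extension: the slope in the new direction is
   squeezed between the left and right difference quotients. *)
Lemma supports_extend k s : (k < d)%N -> supports k s ->
  exists s', supports k.+1 s'.
Proof.
move=> kd ks.
pose e : 'cV[R]_d := delta_mx (Ordinal kd) 0.
pose V v := forall i : 'I_d, (k <= i)%N -> v i 0 = 0.
pose phi v := f (z + v) - f z - inner s v.
have phiV v : V v -> 0 <= phi v by move=> /ks; rewrite /phi; lra.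
have phi_conv (t : R) x y : 0 <= t <= 1 ->
    phi (t *: x + (1 - t) *: y) <= t * phi x + (1 - t) * phi y.
  move=> t01; have := fconv _ (z + x) (z + y) t01.
  have -> : t *: (z + x) + (1 - t) *: (z + y) = z + (t *: x + (1 - t) *: y).
    by apply/colP => i; rewrite !mxE; ring.
  rewrite /phi !innerE; lra.
(* Left quotients lie below right quotients, stated without denominators. The weight [a] cancels the
   [e] components, so the mixture falls back into [V], where [phi] is nonnegative. *)
have cross v v' (t t' : R) : V v -> V v' -> 0 < t -> 0 < t' ->
    0 <= t' * phi (v - t *: e) + t * phi (v' + t' *: e).
  move=> Vv Vv' t0 t'0; pose a := t' / (t + t').
  have tt : 0 < t + t' by rewrite addr_gt0.
  have a01 : 0 <= a <= 1.
    by rewrite /a divr_ge0 ?ler_pdivrMr//; lra.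
  have := phi_conv _ (v - t *: e) (v' + t' *: e) a01.
  have -> : a *: (v - t *: e) + (1 - a) *: (v' + t' *: e)
      = a *: v + (1 - a) *: v'.
    by apply/colP => i; rewrite !mxE /a; field; rewrite gt_eqF.
  have /phiV h : V (a *: v + (1 - a) *: v').
    by move=> i ki; rewrite !mxE Vv// Vv'// !mulr0 addr0.
  move=> /(le_trans h); move/(mulr_ge0 (ltW tt)); move: (phi (v - _)) (phi (v' + _)) => p q.
  suff -> : (t + t') * (a * p + (1 - a) * q) = t' * p + t * q by [].
  by rewrite /a; field; rewrite gt_eqF.
pose S := [set c : R | exists v t, [/\ V v, 0 < t & c = (- phi (v - t *: e)) / t]].
have V0 : V 0 by move=> i _; rewrite mxE.
have Sub v' t' : V v' -> 0 < t' -> ubound S (phi (v' + t' *: e) / t').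
  move=> Vv' t'0 _ [v [t [Vv t0 ->]]].
  rewrite ler_pdivrMr// mulrAC ler_pdivlMr//.
  by have := cross _ _ _ _ Vv Vv' t0 t'0; lra.
have S0 : S !=set0 by exists ((- phi (0 - 1 *: e)) / 1), 0, 1; split.
pose c := sup S.
have cP v t : V v -> c * t <= phi (v + t *: e).
  move=> Vv; have [t0|t0|->] := ltgtP t 0.
  - have : (- phi (v - (- t) *: e)) / (- t) <= c.
      apply: ub_le_sup; first by eexists; exact: (Sub 0 1).
      by exists v, (- t); split => //; lra.
    by rewrite scaleNr opprK ler_pdivrMr; lra.
  - have : c <= phi (v + t *: e) / t by apply: ge_sup => //; exact: Sub.
    by rewrite ler_pdivlMr.
  - by rewrite mulr0 scale0r addr0 phiV.
exists (s + c *: e) => w Vw.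
pose t := w (Ordinal kd) 0; pose v := w - t *: e.
have Vv : V v.
  move=> i; rewrite leq_eqVlt => /orP[/eqP ki|ki].
    have -> : i = Ordinal kd by apply/val_inj.
    by rewrite !mxE !eqxx mulr1 subrr.
  by rewrite !mxE Vw// (negbTE (_ : i != Ordinal kd)) ?mulr0 ?subr0// neq_ltn ki orbT.
have := cP v t Vv; rewrite subrK /phi !innerE.
have -> : inner e w = t.
  rewrite /inner (bigD1 (Ordinal kd))//= big1 ?addr0 ?mxE ?eqxx ?mul1r// => i ik.
  by rewrite mxE (negbTE ik) mul0r.
by lra.
Qed.

End Extension.

(** Start from the zero functional on the trivial subspace and extend it one coordinate at a time.
    The rate needs a subgradient at the averaged point, where the method supplies none. *)
Lemma subgradient_exists f z : convex_function setT f ->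
  subdifferential f z !=set0.
Proof.
move=> /convex_functionW fconv.
have [s ds] : exists s, supports f z d s.
  suff H k : (k <= d)%N -> exists s, supports f z k s by exact: H.
  elim: k => [_|k IHk kd].
    exists 0 => v v0; have -> : v = 0 by apply/colP => i; rewrite v0// mxE.
    by rewrite /inner big1 ?addr0// => i _; rewrite mxE mul0r.
  by have [s] := IHk (ltnW kd); exact: supports_extend.
exists s => x; have := ds (x - z); rewrite [z + _]addrC subrK; apply => i.
by rewrite leqNgt ltn_ord.
Qed.

End Subgradients.

(** * Hölder smoothness as inexact quadratic smoothness *)

Section HolderSmoothness.
Context {R : realType}.

(* Weighted AM-GM for x and 1, from 1 + y <= exp y at y = (1 - p) ln x and
   y = - p ln x. *)
Lemma powR_AGM (x p : R) : 0 <= x -> 0 <= p <= 1 -> x `^ p <= p * x + (1 - p).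
Proof.
rewrite le_eqVlt => /orP[/eqP <-|x0] /andP[p0 p1].
  have [->|pN0] := eqVneq p 0; first by rewrite powRr0; lra.
  by rewrite powR0//; lra.
rewrite /powR gt_eqF//; set y := ln x.
have G0 : 0 < expR (p * y) by exact: expR_gt0.
have xE : x = expR (p * y) * expR ((1 - p) * y).
  by rewrite -expRD -mulrDl addrC subrK mul1r lnK.
have oneE : 1 = expR (p * y) * expR (- p * y).
  by rewrite -expRD -mulrDl subrr mul0r expR0.
have := ler_pM2l G0 (1 + (1 - p) * y) (expR ((1 - p) * y)).
rewrite expR_ge1Dx -xE => hx.
have := ler_pM2l G0 (1 + (- p) * y) (expR (- p * y)).
rewrite expR_ge1Dx -oneE => h1.
have := ler_wpM2l p0 hx; have q0 : 0 <= 1 - p by lra.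
have := ler_wpM2l q0 h1; move: (expR _) => G; nra.
Qed.

(* The inexact smoothness constant that makes the Hölder bound quadratic at
   the scale D / sqrt K. *)
Definition inexact_modulus (M nu D K : R) : R :=
  M * D `^ (nu - 1) * K `^ ((1 - nu) / 2).

(** The powers of K combine by (1 - nu)/2 - 1 = -(1 + nu)/2. The left side is the additive error of
    the quadratic model and, up to a constant, the final accuracy. *)
Lemma inexact_modulusE (M nu D K : R) : 0 < D -> 0 < K ->
  inexact_modulus M nu D K * D ^+ 2 / K =
  M * D `^ (nu + 1) * K^-1 `^ ((1 + nu) / 2).
Proof.
move=> D0 K0; rewrite -(powR_inv1 (ltW K0)) -powRrM /inexact_modulus.
rewrite -mulrA -!(mulrA M); congr (_ * _).
rewrite -(powR_mulrn 2 (ltW D0)) mulrACA.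
rewrite -!powRD ?(gt_eqF K0) ?(gt_eqF D0) ?implybT//.
by congr (_ `^ _ * _ `^ _); field.
Qed.

Lemma inexact_modulus_gt0 (M nu D K : R) : 0 < M -> 0 < D -> 0 < K ->
  0 < inexact_modulus M nu D K.
Proof. by move=> *; rewrite !mulr_gt0 ?powR_gt0. Qed.

(** AM-GM for x = K t^2 / D^2 with exponent p = (1 + nu)/2 gives p x + (1 - p). This is at most p (x
    + 1) because nu >= 0 makes p >= 1/2, and the common factor p absorbs the denominator 1 + nu. *)
Lemma holder_power_le_quadratic (M nu D K t : R) :
  0 < M -> 0 <= nu <= 1 -> 0 < D -> 0 < K -> 0 <= t ->
  M / (1 + nu) * t `^ (1 + nu) <= inexact_modulus M nu D K / 2 * t ^+ 2
    + inexact_modulus M nu D K * D ^+ 2 / K / 2.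
Proof.
move=> M0 nu01 D0 K0 t0; set L := inexact_modulus M nu D K.
pose x := t ^+ 2 * (K / D ^+ 2); pose p := (1 + nu) / 2.
have D2 : 0 < D ^+ 2 by rewrite exprn_gt0.
have p01 : 0 <= p <= 1 by rewrite /p; lra.
have x0 : 0 <= x by rewrite /x mulr_ge0 ?sqr_ge0// divr_ge0 ?sqr_ge0 ?ltW.
set E := L * D ^+ 2 / K.
have E0 : 0 < E by rewrite /E /L divr_gt0 ?mulr_gt0 ?powR_gt0.
(* This is t^2 = (D^2 / K) x raised to the power p. *)
have tE : M * t `^ (1 + nu) = E * x `^ p.
  have -> : E = M * D `^ (nu + 1) * K^-1 `^ ((1 + nu) / 2).
    exact: inexact_modulusE.
  have -> : nu + 1 = 2%:R * p by rewrite /p; field.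
  have -> : 1 + nu = 2%:R * p by rewrite /p; field.
  have -> : 2%:R * p / 2 = p by field.
  rewrite !(powRrM _ 2%:R) (powR_mulrn 2 (ltW D0)) (powR_mulrn 2 t0).
  have Ki : 0 <= K^-1 by rewrite invr_ge0 ltW.
  rewrite -2!mulrA -(powRM p Ki x0) -(powRM p (ltW D2) (mulr_ge0 Ki x0)).
  by congr (_ * _ `^ _); rewrite /x; field; rewrite !gt_eqF.
have L2 : L / 2 * t ^+ 2 = E * (x / 2).
  by rewrite /E /x; field; rewrite !gt_eqF.
have nu1 : 0 < 1 + nu by lra.
rewrite mulrAC tE L2 ler_pdivrMr//.
have -> : E * (x / 2) + E / 2 = E * ((x + 1) / 2) by field.
rewrite -[X in _ <= X]mulrA (ler_pM2l E0); apply: le_trans (powR_AGM _ _ x0 p01) _.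
by rewrite /p; nra.
Qed.

Context {d : nat}.
Implicit Types (f : 'cV[R]_d -> R) (u v w x z s l p q : 'cV[R]_d).

Definition inexact_smooth (L delta : R) f := forall x z s,
  subdifferential f z s ->
  f x <= f z + inner s (x - z) + L / 2 * inner (x - z) (x - z) + delta / 2.

Lemma holder_inexact_smooth (M nu D K : R) f :
  0 < M -> 0 <= nu <= 1 -> 0 < D -> 0 < K -> holder_smooth M nu f ->
  let L := inexact_modulus M nu D K in inexact_smooth L (L * D ^+ 2 / K) f.
Proof.
move=> M0 nu01 D0 K0 fH L x z s /fH => /(_ x) /andP[_ fx].
have := holder_power_le_quadratic _ _ _ _ _ M0 nu01 D0 K0 (enorm_ge0 (x - z)).
by rewrite enorm_sqr -/L; lra.
Qed.

(** At the gradient-type step w = x - (s - l)/L, the quadratic upper bound from [x] must exceed the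
    linear lower bound from [z]. For delta = 0 this is the classical cocoercivity inequality. *)
Lemma inexact_smooth_cocoercive (L delta : R) f x z s l :
  0 < L -> inexact_smooth L delta f ->
  subdifferential f z l -> subdifferential f x s ->
  f z + inner l (x - z) + (2 * L)^-1 * inner (s - l) (s - l) - delta / 2 <= f x.
Proof.
move=> L0 fL zl xs; pose w := x - L^-1 *: (s - l).
have := zl w; have := fL w x s xs.
have -> : w - x = - (L^-1 *: (s - l)) by rewrite /w addrC addKr.
have -> : w - z = (x - z) - L^-1 *: (s - l) by rewrite /w addrAC.
rewrite (innerDr l (x - z)) !innerNr !innerNl !innerZr !innerZl opprK.
set a := inner (s - l) (s - l).
have -> : inner s (s - l) = a + inner l (s - l).
  by rewrite /a -innerDl subrK.
have -> : L / 2 * (L^-1 * (L^-1 * a)) = (2 * L)^-1 * a by field; rewrite gt_eqF.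
set B := inner l (s - l).
have -> : L^-1 * (a + B) = 2 * ((2 * L)^-1 * a) + L^-1 * B.
  by field; rewrite gt_eqF.
by move: ((2 * L)^-1 * a) (L^-1 * B) => P Q; lra.
Qed.

(** Cocoercivity bounds |s - l|^2 by the linearization gap at [z], which inexact smoothness bounds
    in turn. It replaces Lipschitz continuity of the gradient and controls the initial multiplier
    error. *)
Lemma subgradient_dist_le (L delta : R) f x z s l :
  0 < L -> inexact_smooth L delta f ->
  subdifferential f z l -> subdifferential f x s ->
  inner (s - l) (s - l) <= L ^+ 2 * inner (x - z) (x - z) + 2 * L * delta.
Proof.
move=> L0 fL zl xs.
have := inexact_smooth_cocoercive _ _ _ _ _ _ _ L0 fL zl xs.
have := fL x z l zl; move: (inner (s - l) _) (inner (x - z) _) => S Z.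
move=> h1 h2; have : (2 * L)^-1 * S <= L / 2 * Z + delta by lra.
by rewrite ler_pdivrMl ?mulr_gt0//; nra.
Qed.

End HolderSmoothness.

(** * Analysis of a single iteration *)

Section OneStep.
Context {R : realType} {d : nat}.
Implicit Types (l u x s q p w : 'cV[R]_d).

(** With residual [G], moving by -G/(eta + rho) would lower the quadratic by |G|^2 / (2 (eta +
    rho)), so minimality forces G = 0. Combined with the multiplier update, the identity reads
    lambda_{k+1} = s_k + eta (x_{k+1} - x_k). *)
Lemma quadratic_argmin_stationary (eta rho : R) x x' s p w :
  0 < eta -> 0 < rho ->
  argmin (fun v => (inner (s - p) v + eta / 2 * enorm (v - x) ^+ 2
                      + rho / 2 * enorm (w - v) ^+ 2)%:E) x' ->
  s - p + eta *: (x' - x) = rho *: (w - x').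
Proof.
move=> eta0 rho0 xmin; pose G := s - p + eta *: (x' - x) - rho *: (w - x').
suff : G = 0 by move/eqP; rewrite subr_eq0 => /eqP.
pose c := (eta + rho)^-1.
have := xmin (x' - c *: G); rewrite lee_fin !enorm_sqr.
have -> : x' - c *: G - x = (x' - x) + (- c) *: G by rewrite addrAC scaleNr.
have -> : w - (x' - c *: G) = (w - x') + c *: G by rewrite opprB addrA addrAC.
have -> : x' - c *: G = x' + (- c) *: G by rewrite scaleNr.
have sq a v (t : R) : inner (a + t *: v) (a + t *: v)
    = inner a a + 2 * t * inner a v + t ^+ 2 * inner v v.
  by rewrite !innerE (innerC v a); ring.
rewrite !sq (innerDr (s - p) x') (innerZr (s - p)).
have : inner (s - p) G + eta * inner (x' - x) G - rho * inner (w - x') G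
    = inner G G.
  have GE v : inner G v = inner (s - p) v + eta * inner (x' - x) v
      - rho * inner (w - x') v by rewrite /G (innerDl _ (_ + _)) innerNl innerZl
        (innerDl _ (s - p)) innerZl.
  by rewrite GE.
move: (inner (s - p) G) (inner (x' - x) G) (inner (w - x') G) => a1 a2 a3 GG.
move: (inner _ x') (inner (x' - x) _) (inner (w - x') _) => b1 b2 b3 h.
apply: inner_eq0; move: GG h; move: (inner G G) => N GG h.
have c0 : 0 < c by rewrite invr_gt0 addr_gt0.
have ce : c * (eta + rho) = 1 by rewrite mulVf// gt_eqF// addr_gt0.
have : 0 <= c * (- N / 2).
  suff <- : - c * (a1 + eta * a2 - rho * a3)
    + c * (c * (eta + rho)) * N / 2 = c * (- N / 2) by nra.
  by rewrite GG ce; field.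
by rewrite pmulr_rge0//; lra.
Qed.

(* All terms are separable over coordinates; with c = (k+2)/(k+1),
   dl = u - x' and e = u - q, the slack in each coordinate is
   eta ((4 - 2c) e^2 + (2c - 1/2) (e - dl)^2) plus a multiple of (p' - l)^2. *)
Lemma one_step_gap (eta kap : R) l u x x' s q p p' :
  0 < eta -> 1 <= kap ->
  p' = p + (4 * eta / kap) *: (u - x') -> p' = s + eta *: (x' - x) ->
  (kap + 1) * (inner l (u - x) - inner s (q - x)
    - (2 * eta)^-1 * inner (s - l) (s - l) + inner p (q - u))
  <= kap * (kap + 1) / (8 * eta) * inner (p - l) (p - l)
     - (kap + 1) * (kap + 2) / (8 * eta) * inner (p' - l) (p' - l)
     + (kap + 1) * eta / 2 * inner (x - q) (x - q)
     - (kap + 2) * eta / 2 * inner (x' - q) (x' - q)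
     + 4 * eta * inner (u - q) (u - q).
Proof.
move=> eta0 kap1 pp' ps; rewrite -subr_ge0.
have kap0 : 0 < kap by lra.
rewrite /inner !mulrDr !mulrN !mulr_sumr -!sumrN -!big_split /= -sumrN -big_split /=.
apply: sumr_ge0 => i _; rewrite !mxE.
have {pp'} := congr1 (fun v : 'cV[R]_d => v i 0) pp'.
have {ps} := congr1 (fun v : 'cV[R]_d => v i 0) ps.
rewrite /= !mxE.
move: (l i 0) (u i 0) (x i 0) (x' i 0) (s i 0) (q i 0) (p i 0) (p' i 0).
move=> {}l {}u {}x {}x' {}s {}q {}p {}p' ps pp'.
have -> : s = p' - eta * (x' - x) by rewrite ps; ring.
pose c := (kap + 1) / kap.
(* The upper bound, which comes from kap >= 1, keeps the slack coefficient 4 - 2c nonnegative. *)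
have c12 : 1 <= c <= 2.
  by rewrite /c ler_pdivlMr// ler_pdivrMr//; lra.
pose slack := eta * ((4 - 2 * c) * (u - q) ^+ 2
     + (2 * c - 1 / 2) * ((u - q) - (u - x')) ^+ 2)
     + (kap + 1) / (4 * eta) * (p' - l) ^+ 2.
have : 0 <= slack.
  apply: addr_ge0.
    by rewrite mulr_ge0 ?(ltW eta0)// addr_ge0// mulr_ge0 ?sqr_ge0//; lra.
  by rewrite mulr_ge0 ?sqr_ge0// divr_ge0//; lra.
congr (_ <= _); rewrite /slack pp' /c; field.
by rewrite !gt_eqF.
Qed.

End OneStep.

(** * Jensen's inequality for extended-valued convex functions *)

Section ConvexCombination.
Context {R : realType} {d : nat}.
Variable g : 'cV[R]_d -> \bar R.
Hypotheses (g_proper : eproper g) (g_convex : econvex g).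

Lemma edom_fineK y : edom g y -> g y = (fine (g y))%:E.
Proof. by move=> gy; rewrite fineK// fin_numElt g_proper.1. Qed.

Lemma le_EFin_edom y (a : R) : (g y <= a%:E)%E -> edom g y /\ fine (g y) <= a.
Proof.
move=> ga; have gy : edom g y by apply: le_lt_trans ga _; rewrite ltry.
by split=> //; rewrite -lee_fin -edom_fineK.
Qed.

Lemma edom_convex x y (t : R) : edom g x -> edom g y -> 0 <= t <= 1 ->
  edom g (t *: x + (1 - t) *: y) /\
  fine (g (t *: x + (1 - t) *: y)) <= t * fine (g x) + (1 - t) * fine (g y).
Proof.
move=> gx gy t01; apply: le_EFin_edom; apply: le_trans (g_convex _ _ _ t01) _.
by rewrite (edom_fineK _ gx) (edom_fineK _ gy) -!EFinM -EFinD.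
Qed.

(** Induction on the number of points: the mean of the earlier points, with their total weight, is
    merged with the last point by two-point convexity. Positive weights keep every partial sum
    invertible. *)
Lemma edom_average (w : nat -> R) (y : nat -> 'cV[R]_d) K : (0 < K)%N ->
  (forall i, 0 < w i) -> (forall i, (i < K)%N -> edom g (y i)) ->
  let W := \sum_(i < K) w i in
  edom g (W^-1 *: \sum_(i < K) w i *: y i) /\
  fine (g (W^-1 *: \sum_(i < K) w i *: y i))
    <= W^-1 * \sum_(i < K) w i * fine (g (y i)).
Proof.
move=> + w0; case: K => // K _; elim: K => [|K IHK] gy /=.
  rewrite !big_ord_recr !big_ord0 /= !add0r scalerA mulrA mulVf ?gt_eqF//.
  by rewrite scale1r mul1r; split=> //; exact: gy.
have [|dK leK] := IHK; first by move=> i iK; apply: gy; rewrite ltnS ltnW.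
have W0 : 0 < \sum_(i < K.+1) w i.
  by rewrite big_ord_recl ltr_pwDl ?sumr_ge0// => i _; exact: ltW.
rewrite !(big_ord_recr K.+1) /=; move: W0 dK leK.
set W := \sum_(i < K.+1) w i; set Y := \sum_(i < K.+1) w i *: y i.
set S := \sum_(i < K.+1) w i * fine (g (y i)) => W0 dK leK.
have WW : 0 < W + w K.+1 by rewrite addr_gt0.
pose t := W / (W + w K.+1).
have t01 : 0 <= t <= 1.
  by rewrite /t ler_pdivrMr// mul1r lerDl (ltW (w0 _)) divr_ge0// ltW.
have [] := edom_convex (W^-1 *: Y) (y K.+1) t dK (gy _ (ltnSn _)) t01.
have -> : t *: (W^-1 *: Y) + (1 - t) *: y K.+1
    = (W + w K.+1)^-1 *: (Y + w K.+1 *: y K.+1).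
  by apply/colP => i; rewrite !mxE /t; field; rewrite !gt_eqF.
move=> dS leS; split=> //; apply: le_trans leS _.
rewrite mulrDr; apply: lerD.
  apply: le_trans (ler_wpM2l (proj1 (andP t01)) leK) _.
  rewrite le_eqVlt; apply/orP; left; apply/eqP.
  by rewrite /t; field; rewrite !gt_eqF.
rewrite le_eqVlt; apply/orP; left; apply/eqP.
by rewrite /t; field; rewrite !gt_eqF.
Qed.

End ConvexCombination.

(** * Convergence of the splitting method for a fixed step size *)

Section PrimalDualSplitting.
Context {R : realType} {m n : nat}.
Variable A : {linear 'cV[R]_n -> 'cV[R]_m}.
Variable f : 'cV[R]_m -> R.
Variable g : 'cV[R]_n -> \bar R.
Hypotheses (g_proper : eproper g) (g_convex : econvex g).
Hypothesis f_convex : convex_function setT f.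
Variables D L : R.
Hypothesis diam_le : forall u q, image_dom A g u -> image_dom A g q ->
  inner (u - q) (u - q) <= D ^+ 2.

Lemma sum_addn2 K : \sum_(i < K) (i + 2)%:R = K%:R * (K%:R + 3) / 2 :> R.
Proof.
elim: K => [|K IHK]; first by rewrite big_ord0 !mul0r.
by rewrite big_ord_recr IHK /= natrD -natr1; field.
Qed.

(** In units of eta D^2, the summed one-step bounds cost at most 7/4 + 4K and the inexactness (K +
    3)/4, against a total weight K(K + 3)/2. The constant 9 gives 9(K + 3)/2, which covers both. *)
Lemma pd_average_gap (K : nat) (eta : R) (y0 ybar : 'cV[R]_n) :
  (0 < K)%N -> 0 < L -> L <= eta -> edom g y0 ->
  inexact_smooth L (L * D ^+ 2 / K%:R) f ->
  pd_output A f g (fun=> eta) (fun k => 4 * eta / k.+1%:R) y0 K ybar ->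
  forall y, (objective A f g ybar <=
    objective A f g y + (9 * eta * D ^+ 2 / K%:R)%:E)%E.
Proof.
move=> K0 L0 Leta y0dom fL [y [x [lam [s [run ->]]]]] v.
case: run => _ xA lam0 ymin sk xmin lamS.
have eta0 : 0 < eta by exact: lt_le_trans Leta.
have KR : 1 <= K%:R :> R by rewrite ler1n.
have KR0 : 0 < K%:R :> R by rewrite ltr0n.
have [vdom|] := boolP (g v < +oo)%E; last first.
  rewrite -leNgt leye_eq => /eqP; rewrite {2}/objective => ->.
  by rewrite addey// addye// leey.
set delta := L * D ^+ 2 / K%:R in fL.
(* [y0] competes with a finite value, so an oracle answer cannot have g = +oo. *)
have ydom k : (k < K)%N -> edom g (y k.+1).
  move=> kK; have := ymin k kK y0 => /= h; rewrite /edom /= ltey.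
  apply/eqP => gE; move: h.
  by rewrite gE addye// leye_eq (edom_fineK _ g_proper _ y0dom) -EFinD.
have [] := @edom_average _ _ g g_proper g_convex
  (fun i => (i + 2)%:R) (fun i => y i.+1) K K0 _ ydom.
  by move=> i; rewrite ltr0n addn2.
rewrite -/(pd_average y K) => bardom lebar.
set z := A (pd_average y K).
have zI : image_dom A g z by exists (pd_average y K).
have x0I : image_dom A g (x 0%N) by rewrite xA; exists y0.
have qI : image_dom A g (A v) by exists v.
(* The dual reference point is taken at the output [z], so that the linear terms in z - A y_{k+1}
   have zero weighted sum. *)
have [l zl] := subgradient_exists f z f_convex.
pose T k := k.+1%:R * (k.+1%:R + 1) / (8 * eta) * inner (lam k - l) (lam k - l)
     + (k.+1%:R + 1) * eta / 2 * inner (x k - A v) (x k - A v).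
(* The weighted mean of [h] is at least the objective gap of the average minus delta/2, by Jensen
   for [g]. *)
pose h k := f z + fine (g (y k.+1)) - f (A v) - fine (g v)
  - inner l (z - A (y k.+1)) - delta / 2.
have step k : (k < K)%N -> (k + 2)%:R * h k <= T k - T k.+1 + 4 * eta * D ^+ 2.
  move=> kK; set u := A (y k.+1).
  have uI : image_dom A g u by exists (y k.+1) => //; exact: ydom.
  have rho0 : 0 < 4 * eta / k.+1%:R by rewrite divr_gt0 ?mulr_gt0// ltr0n.
  have opt := quadratic_argmin_stationary _ _ _ _ _ _ _ eta0 rho0 (xmin k kK).
  have lamE : lam k.+1 = s k + eta *: (x k.+1 - x k).
    rewrite lamS// -opt; apply/colP => i; rewrite !mxE; ring.
  have k1 : 1 <= k.+1%:R :> R by rewrite ler1n.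
  have := one_step_gap _ _ l u _ _ _ (A v) _ _ eta0 k1 (lamS k kK) lamE.
  have := diam_le _ _ uI qI.
  (* Four inequalities bound [h k] by the one-step gap: the subgradient s_k tested at A v,
     cocoercivity between x_k and z, oracle optimality of y_{k+1} against [v], and L <= eta. *)
  have h1 := sk k kK (A v).
  have h2 := inexact_smooth_cocoercive _ _ _ _ _ _ _ L0 fL zl (sk k kK).
  have h3 : fine (g (y k.+1)) + inner (lam k) u
      <= fine (g v) + inner (lam k) (A v).
    have := ymin k kK v; rewrite (edom_fineK _ g_proper _ (ydom k kK)).
    by rewrite (edom_fineK _ g_proper _ vdom) -!EFinD lee_fin.
  have h4 : (2 * eta)^-1 * inner (s k - l) (s k - l)
      <= (2 * L)^-1 * inner (s k - l) (s k - l).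
    by rewrite ler_wpM2r ?inner_ge0// lef_pV2 ?posrE ?mulr_gt0// ler_pM2l.
  have -> : (k + 2)%:R = k.+1%:R + 1 :> R by rewrite natr1 addn2.
  have -> : T k.+1 = (k.+1%:R + 1) * (k.+1%:R + 2) / (8 * eta)
      * inner (lam k.+1 - l) (lam k.+1 - l)
      + (k.+1%:R + 2) * eta / 2 * inner (x k.+1 - A v) (x k.+1 - A v).
    by rewrite /T -[k.+2%:R]natr1; congr (_ * _ / _ * _ + _ * _ / _ * _); ring.
  set G := (X in _ * X <= _) => hD hG.
  have hG' : h k <= G.
    move: h1 h2 h3 h4; rewrite /h /G !innerDr !innerNr; lra.
  apply: le_trans (ler_wpM2l _ hG') _; first by lra.
  apply: le_trans hG _; rewrite /T.
  have := ler_wpM2l (ltW eta0) hD; lra.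
have sum_step j : (j <= K)%N ->
    \sum_(k < j) (k + 2)%:R * h k <= T 0%N - T j + 4 * eta * D ^+ 2 * j%:R.
  elim: j => [|j IHj] jK; first by rewrite big_ord0 subrr mulr0 addr0.
  rewrite big_ord_recr /= -[j.+1%:R]natr1.
  by have := step j jK; have := IHj (ltnW jK); lra.
have TK : 0 <= T K.
  by rewrite /T addr_ge0// mulr_ge0 ?inner_ge0// divr_ge0 ?mulr_ge0//; lra.
(* The dual term contributes 3/4, from |lambda_0 - l|^2 <= L^2 D^2 + 2 L delta <= 3 L^2 D^2 and L <=
   eta; the primal term contributes 1. *)
have T0 : T 0%N <= 7 / 4 * eta * D ^+ 2.
  have := subgradient_dist_le _ _ _ _ _ _ _ L0 fL zl lam0.
  have hx := diam_le _ _ x0I zI; have hq := diam_le _ _ x0I qI.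
  have D2 : 0 <= D ^+ 2 by exact: sqr_ge0.
  have dD : delta <= L * D ^+ 2.
    by rewrite /delta ler_pdivrMr// ler_peMr// mulr_ge0// ltW.
  rewrite /T; move: (inner (lam _ - l) _) => a ha.
  have a1 : a <= 3 * L ^+ 2 * D ^+ 2.
    apply: le_trans ha _; have LL : 0 <= L ^+ 2 by exact: sqr_ge0.
    have := ler_wpM2l LL hx; have := ler_wpM2l (ltW L0) dD; lra.
  have a2 : 1 * (1 + 1) / (8 * eta) * a <= 3 / 4 * eta * D ^+ 2.
    have -> : 1 * (1 + 1) / (8 * eta) * a = a / (4 * eta).
      by field; rewrite gt_eqF.
    rewrite ler_pdivrMr ?mulr_gt0//; apply: le_trans a1 _.
    have : L ^+ 2 <= eta ^+ 2 by rewrite lerXn2r ?nnegrE ?(ltW L0) ?(ltW eta0).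
    by move/(ler_wpM2r D2); lra.
  by have := ler_wpM2l (ltW eta0) hq; lra.
set S := \sum_(i < K) (i + 2)%:R : R in lebar.
have S0 : 0 < S by rewrite /S sum_addn2 divr_gt0 ?mulr_gt0//; lra.
have sumh : \sum_(k < K) (k + 2)%:R * h k
    = S * (f z - f (A v) - fine (g v) - delta / 2)
      + \sum_(k < K) (k + 2)%:R * fine (g (y k.+1)).
  (* By linearity of [A], [z] is the weighted mean of the points A y_{k+1}. *)
  have zsum : \sum_(k < K) (k + 2)%:R * inner l (z - A (y k.+1)) = 0.
    have lin (F : 'I_K -> 'cV[R]_m) :
        inner l (\sum_k F k) = \sum_k inner l (F k).
      elim/big_rec2: _ => [|k a b _ <-]; last by rewrite innerDr.
      by rewrite -(scale0r 0) innerZr mul0r.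
    under eq_bigr do rewrite -innerZr.
    rewrite -lin; under eq_bigr do rewrite scalerBr.
    rewrite sumrB -scaler_suml /z /pd_average linearZ_LR scalerA divff ?gt_eqF//.
    rewrite scale1r linear_sum; under eq_bigr do rewrite linearZ_LR.
    by rewrite subrr -(scale0r 0) innerZr mul0r.
  rewrite /S mulr_suml -[LHS]addr0 -[X in _ + X = _]zsum -!big_split /=.
  by apply: eq_bigr => k _; rewrite /h; ring.
have := sum_step K (leqnn K); rewrite sumh => hS.
rewrite /objective -/z (edom_fineK _ g_proper _ bardom).
rewrite (edom_fineK _ g_proper _ vdom) -!EFinD lee_fin.
have hbar : S * fine (g (pd_average y K))
    <= \sum_(k < K) (k + 2)%:R * fine (g (y k.+1)).
  by have := ler_wpM2l (ltW S0) lebar; rewrite mulVKf ?gt_eqF.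
rewrite -(ler_pM2l S0).
suff : S * (delta / 2) + 7 / 4 * eta * D ^+ 2 + 4 * eta * D ^+ 2 * K%:R
    <= S * (9 * eta * D ^+ 2 / K%:R) by lra.
have eD : 0 <= eta * D ^+ 2 by rewrite mulr_ge0 ?sqr_ge0 ?ltW.
have dle : delta <= eta * D ^+ 2 / K%:R.
  by rewrite /delta ler_pM2r ?invr_gt0// ler_wpM2r ?sqr_ge0.
apply: le_trans (_ : S * (eta * D ^+ 2 / K%:R / 2) + 7 / 4 * eta * D ^+ 2 + 4 * eta * D ^+ 2 * K%:R <= _).
  by rewrite !lerD2r ler_pM2l// ler_pM2r.
rewrite /S sum_addn2; move: KR KR0; move: (K%:R : R) => k k1 k0.
have -> : k * (k + 3) / 2 * (eta * D ^+ 2 / k / 2)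
    = (k + 3) / 4 * (eta * D ^+ 2) by field; rewrite gt_eqF.
have -> : k * (k + 3) / 2 * (9 * eta * D ^+ 2 / k)
    = 9 * (k + 3) / 2 * (eta * D ^+ 2) by field; rewrite gt_eqF.
by move: eD; rewrite -!(mulrA _ eta); move: (eta * _) => e e0; nra.
Qed.

End PrimalDualSplitting.

(** * Binary logarithms and dyadic rounding *)

Section BinaryLogarithm.
Context {R : realType}.
Implicit Types x y : R.

Lemma ln2_itv : 1 / 2 <= (ln 2 : R) <= 1.
Proof.
have l2 : -1 < - (1 / 2) :> R by lra.
apply/andP; split.
  have := le_ln1Dx l2; have -> : 1 + - (1 / 2) = 2^-1 :> R by field.
  by rewrite lnV ?posrE//; lra.
have := @le_ln1Dx R 1; have -> : 1 + 1 = 2 :> R by ring.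
by apply; lra.
Qed.

Lemma ln2_gt0 : 0 < ln 2 :> R.
Proof. by have := ln2_itv; lra. Qed.

Lemma log2K x : 0 < x -> 2 `^ log2 x = x.
Proof.
move=> x0; rewrite /powR gt_eqF// /log2 divfK ?gt_eqF ?ln2_gt0//.
by rewrite lnK.
Qed.

Lemma log2M x y : 0 < x -> 0 < y -> log2 (x * y) = log2 x + log2 y.
Proof. by move=> x0 y0; rewrite /log2 lnM ?posrE// mulrDl. Qed.

Lemma log2_powR x y : log2 (x `^ y) = y * log2 x.
Proof. by rewrite /log2 ln_powR mulrA. Qed.

Lemma ler_log2 x y : 0 < x -> x <= y -> log2 x <= log2 y.
Proof.
move=> x0 xy; rewrite /log2 ler_pM2r ?invr_gt0 ?ln2_gt0//.
by rewrite ler_ln ?posrE// (lt_le_trans x0).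
Qed.

Lemma log2_2 : log2 2 = 1 :> R.
Proof. by rewrite /log2 divff// gt_eqF// ln2_gt0. Qed.

Lemma log2_8 : log2 8 = 3 :> R.
Proof.
have -> : 8 = 2 * (2 * 2) :> R by ring.
by rewrite !log2M// log2_2; ring.
Qed.

(** The exponent is the ceiling of log2 x. Its logarithmic bounds serve to locate it in the search
    grid, the multiplicative ones to control the step size. *)
Lemma exists_dyadic_between x : 0 < x ->
  exists j : int, [/\ log2 x <= j%:~R, j%:~R < log2 x + 1,
    x <= 2 ^ j & 2 ^ j <= 2 * x].
Proof.
move=> x0; have /andP[] := ceil_itv (log2 x); set j := Num.ceil _ => j1 j2.
have j1' : j%:~R < log2 x + 1 by move: j1; rewrite intrB mulr1z; lra.
exists j; split=> //.
  by rewrite -powR_intmul// -{1}(log2K _ x0) ler_powR//; lra.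
have -> : 2 * x = 2 `^ (1 + log2 x).
  by rewrite powRD ?pnatr_eq0 ?implybT// log2K// powRr1.
by rewrite -powR_intmul// ler_powR//; lra.
Qed.

(* The tangent bound ln x <= ln c + x / c - 1 at c = 8 b. *)
Lemma mul_log2_le b x : 2 <= b -> 4 * b * log2 (4 * b) <= x ->
  b * log2 x <= x.
Proof.
move=> b2 bx; have /andP[l1 l2] := ln2_itv; have l0 := ln2_gt0.
have b0 : 0 < b by lra.
have l4b : 0 <= log2 (4 * b).
  by rewrite divr_ge0 ?ltW// ln_gt0//; lra.
have l4b1 : 1 <= log2 (4 * b) by rewrite -[X in X <= _]log2_2; apply: ler_log2 => //; lra.
have x0 : 0 < x by nra.
have b8 : 0 < 8 * b by rewrite mulr_gt0.
have lnx : ln x <= ln 2 + ln (4 * b) + (x / (8 * b) - 1).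
  have h : -1 < x / (8 * b) - 1 by rewrite ltrBrDr addNr divr_gt0.
  have := le_ln1Dx h; have -> : 1 + (x / (8 * b) - 1) = x / (8 * b) by ring.
  rewrite ln_div ?posrE//; have -> : ln (8 * b) = ln 2 + ln (4 * b).
    by rewrite -lnM ?posrE ?mulr_gt0//; congr ln; ring.
  by lra.
rewrite /log2 mulrA ler_pdivrMr//.
have h : 4 * b * ln (4 * b) <= x * ln 2.
  by move: bx; rewrite /log2 mulrA ler_pdivrMr.
have := ler_wpM2l (ltW b0) lnx.
(* The three terms are at most 0, (x ln 2)/4 and (x ln 2)/4, using ln 2 <= 1, the hypothesis on [x],
   and ln 2 >= 1/2 respectively. *)
have -> : b * (ln 2 + ln (4 * b) + (x / (8 * b) - 1)) =
  b * (ln 2 - 1) + (4 * b * ln (4 * b)) / 4 + x / 8 by field; rewrite gt_eqF.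
move=> bl; apply: le_trans bl _.
have h1 : b * (ln 2 - 1) <= 0 by rewrite pmulr_rle0//; lra.
have h2 : x / 2 <= x * ln 2 by have := ler_wpM2l (ltW x0) l1; lra.
by move: (b * (ln 2 - 1)) (4 * b * _) (x * ln 2) h h1 h2 => p q s; lra.
Qed.

End BinaryLogarithm.

(** * Cost, grid coverage and accuracy of the parameter searches *)

Section ParameterSearch.
Context {R : realType}.
Implicit Types (b r : R) (N : nat).

Lemma fb_cost_le b N : fb_cost b N <= N%:Z.
Proof.
(* For K = 0 the radius divides by zero, harmlessly: the cost has the factor K. *)
rewrite /fb_cost /fb_radius; case: (fb_iters b N) => [|K].
  by rewrite mulr0.
rewrite -(ler_int R) intrM intrD intrM /=.
have K0 : 0 < K.+1%:R :> R by rewrite ltr0n.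
rewrite -ler_pdivlMr//; set F : R := (Num.floor _)%:~R.
have : F <= (N%:R / K.+1%:R - 1) / 2.
  by case/andP: (floor_itv ((N%:R / K.+1%:R - 1) / 2 : R)).
move: F => F; move: (N%:R / _) => q h.
by suff : 2 * F + 1 <= q by []; move: h; lra.
Qed.

Lemma ub_budgetS b t : ub_budget b t.+1 = (2 * ub_budget b t)%N.
Proof. by rewrite /ub_budget expnS mulnA. Qed.

(** Budgets double from stage to stage, so their sum is below twice the last one. *)
Lemma ub_calls_le b t : ub_calls b t <= (2 * ub_budget b t)%N%:Z.
Proof.
elim: t => [|t IHt]; rewrite /ub_calls.
  rewrite big_ord_recl big_ord0 addr0; apply: le_trans (fb_cost_le _ _) _.
  by rewrite lez_nat leq_pmull.
rewrite big_ord_recr /=; apply: le_trans (lerD IHt (fb_cost_le _ _)) _.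
by rewrite -PoszD lez_nat ub_budgetS; lia.
Qed.

(** Maximality of [tN] gives N < C_{tN+1} <= 2 N_{tN+1} = 4 N_{tN}. A stage may spend less than its
    budget, so N_{tN} may exceed N; descending one stage while it does keeps N < 4 N_t. *)
Lemma exists_matching_stage b N tN : ub_last_stage b N tN ->
  (ub_budget0 b <= N)%N ->
  exists t, [/\ (t <= tN)%N, (ub_budget b t <= N)%N
    & (N < 4 * ub_budget b t)%N].
Proof.
move=> [_ last] N0.
have : (N < 4 * ub_budget b tN)%N.
  rewrite ltnNge; apply/negP => le4; have := last tN.+1; rewrite ltnn.
  suff h : ub_calls b tN.+1 <= N%:Z by move/(_ h).
  by apply: le_trans (ub_calls_le _ _) _; rewrite lez_nat ub_budgetS; lia.
move=> {last}; elim: tN => [|T IHT] lt4.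
  by exists 0%N; split=> //; rewrite /ub_budget mul1n.
have [leN|ltN] := leqP (ub_budget b T.+1) N; first by exists T.+1.
have [|t [tT h1 h2]] := IHT; first by move: ltN; rewrite ub_budgetS; lia.
by exists t; split=> //; exact: leqW.
Qed.

(** Since N/K >= b log2 N, the radius before rounding is at least (b log2 N - 1)/2, while log2 L
    lies between log2 r and log2 r + (1 - nu)/2 log2 N. In the upper condition, 3 is this 1 plus
    twice the loss from rounding log2 L up. *)
Lemma fb_radius_covers M nu D b N : 0 < M -> 0 <= nu <= 1 -> 0 < D -> 2 <= b ->
  let r := M * D `^ (nu - 1) in let K := fb_iters b N in
  (0 < K)%N -> 1 <= log2 N%:R :> R ->
  3 + 2 * log2 r <= (b - 1 + nu) * log2 N%:R ->
  3 - 2 * log2 r <= b * log2 N%:R ->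
  let L := inexact_modulus M nu D K%:R in
  exists j : int, [/\ - fb_radius b N <= j <= fb_radius b N,
    L <= 2 ^ j & 2 ^ j <= 2 * L].
Proof.
move=> M0 nu01 D0 b2 r K K0 lN1 r_up r_lo L.
have KR : 1 <= K%:R :> R by rewrite ler1n.
have KR0 : 0 < K%:R :> R by rewrite ltr0n.
have r0 : 0 < r by rewrite mulr_gt0 ?powR_gt0.
have L0 : 0 < L by exact: inexact_modulus_gt0.
have B1 : 1 <= b * log2 N%:R by nra.
have B0 : 0 < b * log2 N%:R by lra.
have KB : K%:R * (b * log2 N%:R) <= N%:R.
  rewrite -ler_pdivlMr// /K /fb_iters truncn_le.
  by rewrite divr_ge0 ?ler0n// ltW.
have NK : b * log2 N%:R <= N%:R / K%:R by rewrite ler_pdivlMr// mulrC.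
have KN : K%:R <= N%:R :> R by nra.
have lK0 : 0 <= log2 K%:R :> R by apply: divr_ge0; [exact: ln_ge0 | exact: ltW ln2_gt0].
have lKN := ler_log2 _ _ KR0 KN.
have lL : log2 L = log2 r + (1 - nu) / 2 * log2 K%:R.
  by rewrite /L /inexact_modulus log2M ?powR_gt0// log2_powR.
have [j [j1 j2 Lj jL]] := exists_dyadic_between _ L0.
(* As [j] and -j are integers, both can be compared with the radius before rounding down. *)
exists j; split=> //; rewrite lerNl /fb_radius -/K !floor_ge_int intrN.
move: (log2 K%:R) (log2 N%:R) lK0 lKN lL lN1 r_up r_lo NK B1 B0 KB => lK lN.
move=> lK0 lKN lL lN1 r_up r_lo NK _ _ _.
have h1 : (1 - nu) * lK <= (1 - nu) * lN by apply: ler_wpM2l => //; lra.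
have h2 : 0 <= (1 - nu) * lK by apply: mulr_ge0 => //; lra.
move: j1 j2; rewrite lL; move: (j%:~R) => J j1 j2.
by apply/andP; split; lra.
Qed.

(** Truncating a real number that is at least 1 loses at most a factor 2. *)
Lemma fb_iters_ge b N : 0 < b * log2 N%:R -> b * log2 N%:R <= N%:R ->
  (0 < fb_iters b N)%N /\
  (fb_iters b N)%:R^-1 <= 2 * (b * log2 N%:R) / N%:R :> R.
Proof.
move=> B0 BN; set B := b * log2 N%:R in B0 BN *.
have N0 : 0 < N%:R :> R by exact: lt_le_trans BN.
have x1 : 1 <= N%:R / B by rewrite ler_pdivlMr// mul1r.
have K0 : (0 < fb_iters b N)%N by rewrite /fb_iters truncn_gt0.
split=> //.
have K1 : 1 <= (fb_iters b N)%:R :> R by rewrite ler1n.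
have x0 : 0 <= N%:R / B by lra.
have /andP[_] := truncn_itv x0; rewrite -/(fb_iters b N) -natr1 => xK.
have -> : 2 * B / N%:R = (N%:R / B / 2)^-1 by field; rewrite !gt_eqF.
by rewrite lef_pV2 ?posrE//; lra.
Qed.

Context {m n : nat}.
Variable A : {linear 'cV[R]_n -> 'cV[R]_m}.
Variable f : 'cV[R]_m -> R.
Variable g : 'cV[R]_n -> \bar R.
Hypotheses (g_proper : eproper g) (g_convex : econvex g).
Hypothesis f_convex : convex_function setT f.

(** A real [sup] is an upper bound only of a bounded set; boundedness follows from |x - z|^2 <=
    2|x|^2 + 2|z|^2 <= 4 C^2. *)
Lemma image_diam_sqr_le (C : R) u q :
  (forall x, image_dom A g x -> enorm x <= C) ->
  image_dom A g u -> image_dom A g q ->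
  inner (u - q) (u - q) <= image_diam A g ^+ 2.
Proof.
move=> bd uI qI; rewrite -enorm_sqr.
set S := [set enorm (x - z) | x in image_dom A g & z in image_dom A g].
have sqC x : image_dom A g x -> inner x x <= C ^+ 2.
  move=> /bd xC; rewrite -enorm_sqr lerXn2r ?nnegrE ?enorm_ge0//.
  by apply: le_trans xC; exact: enorm_ge0.
have Sub : has_ubound S.
  exists (Num.sqrt (4 * C ^+ 2)) => _ [x xI [z zI <-]].
  rewrite /enorm ler_wsqrtr//.
  have := sqC _ xI; have := sqC _ zI; have := inner_ge0 (x + z).
  rewrite !innerE (innerC z x); lra.
rewrite lerXn2r ?nnegrE ?enorm_ge0//.
  apply: le_trans (enorm_ge0 (u - q)) _.
  by apply: (ub_le_sup Sub); exists u => //; exists q.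
by apply: (ub_le_sup Sub); exists u => //; exists q.
Qed.

(** The selected output is no worse than that of the grid index with L <= 2^j <= 2L, and the factor
    2 turns the constant 9 into 18. *)
Lemma fixed_budget_gap (M nu D b : R) (N : nat) (y0 yhat : 'cV[R]_n) :
  (forall u q, image_dom A g u -> image_dom A g q ->
    inner (u - q) (u - q) <= D ^+ 2) ->
  0 < M -> 0 <= nu <= 1 -> 0 < D -> 2 <= b -> holder_smooth M nu f ->
  edom g y0 ->
  let r := M * D `^ (nu - 1) in
  1 <= log2 N%:R :> R -> b * log2 N%:R <= N%:R ->
  3 + 2 * log2 r <= (b - 1 + nu) * log2 N%:R ->
  3 - 2 * log2 r <= b * log2 N%:R ->
  fixed_budget_output A f g y0 b N yhat ->
  forall v, (objective A f g yhat <= objective A f g v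
    + (18 * (M * D `^ (nu + 1)
        * (2 * (b * log2 N%:R) / N%:R) `^ ((1 + nu) / 2)))%:E)%E.
Proof.
move=> diam M0 nu01 D0 b2 fH y0dom r lN1 bN r_up r_lo [ybar [runs]].
move=> [jstar [_ jmin ->]] v.
have B0 : 0 < b * log2 N%:R by rewrite mulr_gt0//; lra.
have [K0 Kinv] := fb_iters_ge _ _ B0 bN.
have KR0 : 0 < (fb_iters b N)%:R :> R by rewrite ltr0n.
have [j [js Lj jL]] := fb_radius_covers _ _ _ _ _ M0 nu01 D0 b2 K0 lN1 r_up r_lo.
have L0 := inexact_modulus_gt0 _ nu _ _ M0 D0 KR0.
have fL := holder_inexact_smooth _ _ _ _ _ M0 nu01 D0 KR0 fH.
apply: le_trans (jmin _ js) _.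
apply: le_trans (pd_average_gap _ _ _ g_proper g_convex f_convex _ _ diam
  _ _ _ _ K0 L0 Lj y0dom fL (runs j js) v) _.
apply: leeD => //; rewrite lee_fin.
have := inexact_modulusE M nu _ _ D0 KR0.
set L := inexact_modulus _ _ _ _ in L0 jL Lj fL * => LE.
apply: le_trans (_ : 18 * (L * D ^+ 2 / (fb_iters b N)%:R) <= _).
  have -> : 18 * (L * D ^+ 2 / (fb_iters b N)%:R)
      = 9 * (2 * L) * D ^+ 2 / (fb_iters b N)%:R by ring.
  by rewrite ler_pM2r ?invr_gt0// ler_wpM2r ?sqr_ge0// ler_pM2l.
rewrite LE ler_pM2l// ler_pM2l ?mulr_gt0 ?powR_gt0//.
have Ki0 : 0 <= (fb_iters b N)%:R^-1 :> R by rewrite invr_ge0 ltW.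
apply: ge0_ler_powR => //; first by lra.
by rewrite nnegrE; apply: le_trans Kinv.
Qed.

(** Moving terms across an extended-real inequality requires finiteness: the infimum is bounded
    above by the value at [y0] and below by the value at [p] minus [B]. *)
Lemma sub_ereal_inf_objective_le (p : 'cV[R]_n) (B : R) (y0 : 'cV[R]_n) :
  edom g y0 ->
  (forall v, (objective A f g p <= objective A f g v + B%:E)%E) ->
  (objective A f g p - ereal_inf (range (objective A f g)) <= B%:E)%E.
Proof.
move=> y0dom pB; set P := objective A f g; set pstar := ereal_inf _.
have Pgt v : (-oo < P v)%E.
  by rewrite /P /objective ltNye adde_eq_ninfty negb_or -!ltNye ltNyr g_proper.1.
have y0fin : (P y0 < +oo)%E.
  by rewrite /P /objective (edom_fineK _ g_proper _ y0dom) -EFinD ltry.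
have pfin : P p \is a fin_num.
  rewrite fin_numElt Pgt /=; apply: le_lt_trans (pB y0) _.
  by rewrite lte_add_pinfty// ltry.
have plow : (P p - B%:E <= pstar)%E.
  by apply: le_ereal_inf_tmp => _ [v _ <-]; rewrite leeBlDr.
have starfin : pstar \is a fin_num.
  rewrite fin_numElt; apply/andP; split.
    apply: lt_le_trans plow; rewrite -(fineK pfin) -EFinB ltNyr//.
  by apply: le_lt_trans y0fin; apply: ereal_inf_lbound; exists y0.
by rewrite leeBlDr// addeC -leeBlDr.
Qed.

End ParameterSearch.

(** * Convergence rate of the unbounded-budget search *)

Theorem theorem4p2 (R : realType) (m n : nat)
  (A : {linear 'cV[R]_n -> 'cV[R]_m})
  (f : 'cV[R]_m -> R) (g : 'cV[R]_n -> \bar R)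
  (g_proper : eproper g) (g_closed : eclosed g) (g_convex : econvex g)
  (lmo : forall lambda : 'cV[R]_n,
     argmin (fun y => ((inner lambda y)%:E + g y)%E) !=set0)
  (bounded_image : exists C : R, forall x, image_dom A g x -> enorm x <= C)
  (M nu : R) (M_gt0 : 0 < M) (nu01 : 0 <= nu <= 1)
  (f_convex : convex_function setT f) (f_holder : holder_smooth M nu f)
  (D_gt0 : 0 < image_diam A g)
  (b : R) (b_ge2 : 2 <= b)
  (y0 : 'cV[R]_n) (y0_dom : edom g y0)
  (N : nat) (ybest : 'cV[R]_n)
  (output : unbounded_budget_output A f g y0 b N ybest) :
  let D := image_diam A g in
  let r := M * D `^ (nu - 1) in
  let Nstar := Num.max (4 * b * log2 (4 * b))
                 (Num.max ((8 * r ^+ 2) `^ (b - 1 + nu)^-1)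
                          ((8 / r ^+ 2) `^ b^-1)) in
  let pstar := ereal_inf (range (objective A f g)) in
  4 * Nstar <= N%:R ->
  (objective A f g ybest - pstar <=
   (262 * M * D `^ (nu + 1)
      * (8 * b * log2 N%:R / N%:R) `^ ((1 + nu) / 2))%:E)%E.
Proof.
move=> D r Nstar pstar; rewrite /Nstar !maxr_pMr// !ge_max.
case/and3P=> N_log N_up N_lo.
have [C bdC] := bounded_image.
have diam u q := image_diam_sqr_le A g C u q bdC.
have r0 : 0 < r by rewrite mulr_gt0 ?powR_gt0.
have lb1 : 1 <= log2 (4 * b).
  by rewrite -[X in X <= _]log2_2; apply: ler_log2 => //; lra.
have [yhat [hats [tN [tstar [last _ best ->]]]]] := output.
have N0 : (ub_budget0 b <= N)%N.
  have c0 : 0 <= Num.ceil (4 * b * log2 (4 * b)).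
    have /andP[_] := ceil_itv (4 * b * log2 (4 * b)).
    by rewrite -(ler_int R); apply: le_trans; nra.
  rewrite /ub_budget0 -lez_nat gez0_abs// ceil_le_int.
  by apply: le_trans N_log; nra.
have [t [tT tN1 tN2]] := exists_matching_stage _ _ _ last N0.
set Nt := ub_budget b t in tN1 tN2.
have NtN : Nt%:R <= N%:R :> R by rewrite ler_nat.
have N4 : N%:R <= 4 * Nt%:R :> R by rewrite -natrM ler_nat ltnW.
(* The factor 4 in N >= 4 N* is spent here: with N <= 4 N_t, each of the three lower bounds passes
   to the stage budget N_t. *)
have {}N_log : 4 * b * log2 (4 * b) <= Nt%:R.
  by rewrite -(ler_pM2l (_ : 0 < 4)) ?(le_trans N_log)//; lra.
have {}N_up : (8 * r ^+ 2) `^ (b - 1 + nu)^-1 <= Nt%:R.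
  by rewrite -(ler_pM2l (_ : 0 < 4)) ?(le_trans N_up)//; lra.
have {}N_lo : (8 / r ^+ 2) `^ b^-1 <= Nt%:R.
  by rewrite -(ler_pM2l (_ : 0 < 4)) ?(le_trans N_lo)//; lra.
have Nt2 : 2 <= Nt%:R :> R by nra.
have Nt0 : 0 < Nt%:R :> R by lra.
have lNt1 : 1 <= log2 Nt%:R :> R.
  by rewrite -[X in X <= _]log2_2; apply: ler_log2.
have lNt : log2 Nt%:R <= log2 N%:R :> R by exact: ler_log2.
have r2 : 0 < r ^+ 2 by rewrite exprn_gt0.
have lr2 : log2 (r ^+ 2) = 2 * log2 r.
  by rewrite expr2 log2M//; ring.
have bnu : 0 < b - 1 + nu by lra.
have b0 : 0 < b by lra.
(* The power terms of N* are the two grid conditions in exponential form, with 3 = log2 8. *)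
have r_up : 3 + 2 * log2 r <= (b - 1 + nu) * log2 Nt%:R.
  have r8 : 0 < 8 * r ^+ 2 by exact: mulr_gt0.
  have := ler_log2 _ _ (powR_gt0 _ r8) N_up.
  by rewrite log2_powR log2M// lr2 log2_8 ler_pdivrMl.
have r_lo : 3 - 2 * log2 r <= b * log2 Nt%:R.
  have r8 : 0 < 8 / r ^+ 2 by exact: divr_gt0.
  have := ler_log2 _ _ (powR_gt0 _ r8) N_lo.
  rewrite log2_powR ler_pdivrMl//.
  suff -> : log2 (8 / r ^+ 2) = 3 - 2 * log2 r by [].
  by rewrite -lr2 -log2_8 /log2 ln_div ?posrE// mulrBl.
have bN := mul_log2_le _ _ b_ge2 N_log.
apply: (sub_ereal_inf_objective_le _ _ _ g_proper _ _ y0 y0_dom) => v.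
apply: le_trans (best t tT) _.
apply: le_trans (fixed_budget_gap _ _ _ g_proper g_convex f_convex _ _ _ _ _ _ _
  diam M_gt0 nu01 D_gt0 b_ge2 f_holder y0_dom lNt1 bN r_up r_lo (hats t) v) _.
apply: leeD => //; rewrite lee_fin -!(mulrA _ M) -!(mulrA _ (M * _)) -/Nt -/D.
have MD : 0 < M * D `^ (nu + 1) by rewrite mulr_gt0 ?powR_gt0.
have bl0 : 0 <= 2 * (b * log2 Nt%:R) / Nt%:R by rewrite divr_ge0//; nra.
(* From N_t <= N in the logarithm and 1/N_t <= 4/N in the quotient. The remaining constants compare
   as 18 <= 262. *)
have step : 2 * (b * log2 Nt%:R) / Nt%:R <= 8 * b * log2 N%:R / N%:R.
  rewrite ler_pdivrMr// mulrAC ler_pdivlMr; last by lra.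
  apply: le_trans (_ : 2 * (b * log2 N%:R) * (4 * Nt%:R) <= _); last by lra.
  by apply: ler_pM => //; nra.
apply: ler_pM => //; first by rewrite mulr_ge0 ?powR_ge0// ltW.
  by lra.
rewrite ler_pM2l//; apply: ge0_ler_powR => //; first by lra.
by rewrite nnegrE (le_trans bl0).
Qed.
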